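(* If $\varphi:\mathcal A\to M_n(\mathbb C)$ is a linear isometry, then there exist unitaries $U,V\in M_n(\mathbb C)$ such that $\varphi(A)=UAV$ for every $A\in\mathcal A$.
   Context: $S$ denotes the $n\times n$ nilpotent Jordan block with ones on the superdiagonal and zeros elsewhere. $\mathcal A=\{f(S): f\text{ a complex polynomial}\}$ is the algebra of $n\times n$ upper-triangular Toeplitz matrices. $M_n(\mathbb C)$ carries the operator norm induced by the Euclidean norm on $\mathbb C^n$; a linear isometry is a linear map with $\|\varphi(A)\|=\|A\|$ for all $A$. *)

(* Defs.v *)
From HB Require Import structures.
From mathcomp Require Import all_boot all_order all_algebra.
Set Implicit Arguments. Unset Strict Implicit. Unset Printing Implicit Defensive.
Import Order.TTheory GRing.Theory Num.Theory.
Local Open Scope ring_scope.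

Definition jordanS (C : numClosedFieldType) (n : nat) : 'M[C]_n :=
  \matrix_(i < n, j < n) (j == i.+1 :> nat)%:R.

Definition poly_at_mx (C : numClosedFieldType) (n : nat) (p : {poly C}) (M : 'M[C]_n)
  : 'M[C]_n := \sum_(k < size p) p`_k *: M ^+ k.

Definition in_toeplitz (C : numClosedFieldType) (n : nat) (A : 'M[C]_n) : Prop :=
  exists p : {poly C}, A = poly_at_mx p (jordanS C n).

Definition vnorm2 (C : numClosedFieldType) (n : nat) (x : 'cV[C]_n) : C :=
  \sum_(i < n) `|x i 0| ^+ 2.

Definition opnorm_bound (C : numClosedFieldType) (n : nat) (A : 'M[C]_n) (c : C) : Prop :=
  0 <= c /\ forall x : 'cV[C]_n, vnorm2 (A *m x) <= c ^+ 2 * vnorm2 x.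

Definition is_opnorm (C : numClosedFieldType) (n : nat) (A : 'M[C]_n) (r : C) : Prop :=
  opnorm_bound A r /\ forall c, opnorm_bound A c -> r <= c.

Definition adjmx (C : numClosedFieldType) (n : nat) (U : 'M[C]_n) : 'M[C]_n :=
  (map_mx Num.conj U)^T.

Definition unitary (C : numClosedFieldType) (n : nat) (U : 'M[C]_n) : Prop :=
  adjmx U *m U = 1%:M.

(* Main.v *)
Require Import Defs.
From HB Require Import structures.
From mathcomp Require Import all_boot all_order all_algebra.
From mathcomp Require Import cyclic separable cyclotomic ring.
Import Order.TTheory GRing.Theory Num.Theory.
Local Open Scope ring_scope.
Set Implicit Arguments. Unset Strict Implicit. Unset Printing Implicit Defensive.

(* Write S^j for the powers of the shift and X = phi 1.  For |k| = 1 the Hermitian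
   Toeplitz matrix (k^(i-j)) is f_k(S) + f_k(S)^* with f_k = 1/2 + sum_(j>0) k^-j S^j;
   it is n times a rank one projection.  Comparing |1 + t f(S)| and |X + t phi(f(S))|
   to first order in t shows that G_k = X^* phi(f_k(S)) + phi(f_k(S))^* X is
   nonnegative on K = ker(1 - X^* X) and attains the value n there on a unit vector
   x_k.  For the n roots k of k^n = z, the G_k sum to n X^* X, so G_k x_l = 0 on K for
   k <> l and the x_k are n orthogonal vectors of K: hence X is unitary and the x_k
   diagonalize all the G_k.  Taking Fourier coefficients over these roots and putting
   Y_r = X^* phi(S^r), one gets (Y_r + z Y_(n-r)^* ) x_k = k^r x_k, so that
   (Y_r + z Y_(n-r)^* )(Y_1 + z Y_(n-1)^* ) = Y_(r+1) + z Y_(n-r-1)^* for all |z| = 1.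
   Comparing coefficients of z gives Y_r = Y_1^r and
   Y_1^* Y_1 + Y_1^(n-1) (Y_1^(n-1))^* = 1, which with Y_1^n = 0 forces Y_1 to be
   unitarily equivalent to S. *)

(** * Adjoints, inner products and spectral decomposition *)

Section HermitianSpace.
Variable C : numClosedFieldType.

(* Agrees with [adjmx] on square matrices, up to conversion. *)
Definition dag m n (A : 'M[C]_(m, n)) : 'M[C]_(n, m) := (map_mx Num.conj A)^T.
Definition dot n (x y : 'cV[C]_n) : C := (dag x *m y) 0 0.

Lemma dagE m n (A : 'M[C]_(m, n)) i j : dag A i j = (A j i)^*.
Proof. by rewrite !mxE. Qed.

Lemma dagK m n (A : 'M[C]_(m, n)) : dag (dag A) = A.
Proof. by apply/matrixP=> i j; rewrite !dagE conjCK. Qed.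

Lemma dagD m n (A B : 'M[C]_(m, n)) : dag (A + B) = dag A + dag B.
Proof. by apply/matrixP=> i j; rewrite !mxE rmorphD. Qed.

Lemma dagN m n (A : 'M[C]_(m, n)) : dag (- A) = - dag A.
Proof. by apply/matrixP=> i j; rewrite !mxE rmorphN. Qed.

Lemma dagZ m n a (A : 'M[C]_(m, n)) : dag (a *: A) = a^* *: dag A.
Proof. by apply/matrixP=> i j; rewrite !mxE rmorphM. Qed.

Lemma dag0 m n : dag (0 : 'M[C]_(m, n)) = 0.
Proof. by apply/matrixP=> i j; rewrite !mxE rmorph0. Qed.

Lemma dagM m n p (A : 'M[C]_(m, n)) (D : 'M[C]_(n, p)) : dag (A *m D) = dag D *m dag A.
Proof. by rewrite /dag map_mxM trmx_mul. Qed.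

Lemma dag1 n : dag (1%:M : 'M[C]_n) = 1%:M.
Proof. by rewrite /dag map_mx1 trmx1. Qed.

Lemma dag_sum m n (I : Type) (r : seq I) (P : pred I) (F : I -> 'M[C]_(m, n)) :
  dag (\sum_(i <- r | P i) F i) = \sum_(i <- r | P i) dag (F i).
Proof. by apply: (big_morph _ (@dagD m n) (@dag0 m n)). Qed.

Section Dot.
Variable n : nat.
Implicit Types (x y z : 'cV[C]_n) (A : 'M[C]_n).

Lemma dotE x y : dot x y = \sum_i (x i 0)^* * y i 0.
Proof. by rewrite /dot mxE; apply: eq_bigr => i _; rewrite dagE. Qed.

Lemma dotDr x y z : dot x (y + z) = dot x y + dot x z.
Proof. by rewrite /dot mulmxDr mxE. Qed.

Lemma dotDl x y z : dot (y + z) x = dot y x + dot z x.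
Proof. by rewrite /dot dagD mulmxDl mxE. Qed.

Lemma dotNr x y : dot x (- y) = - dot x y.
Proof. by rewrite /dot mulmxN mxE. Qed.

Lemma dotZr a x y : dot x (a *: y) = a * dot x y.
Proof. by rewrite /dot -scalemxAr mxE. Qed.

Lemma dotZl a x y : dot (a *: y) x = a^* * dot y x.
Proof. by rewrite /dot dagZ -scalemxAl mxE. Qed.

Lemma dot0r x : dot x 0 = 0.
Proof. by rewrite /dot mulmx0 mxE. Qed.

Lemma dot0l x : dot 0 x = 0.
Proof. by rewrite /dot dag0 mul0mx mxE. Qed.

Lemma dotC x y : (dot x y)^* = dot y x.
Proof. by rewrite !dotE rmorph_sum; apply: eq_bigr => i _; rewrite rmorphM /= conjCK mulrC. Qed.

Lemma dot_dagr A x y : dot x (A *m y) = dot (dag A *m x) y.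
Proof. by rewrite /dot dagM dagK mulmxA. Qed.

Lemma dot_dagl A x y : dot (A *m x) y = dot x (dag A *m y).
Proof. by rewrite dot_dagr dagK. Qed.

Lemma dot_sumr x (I : Type) (r : seq I) (P : pred I) (F : I -> 'cV[C]_n) :
  dot x (\sum_(i <- r | P i) F i) = \sum_(i <- r | P i) dot x (F i).
Proof. exact: (big_morph _ (dotDr x) (dot0r x)). Qed.

Lemma vnorm2E x : vnorm2 x = dot x x.
Proof. by rewrite dotE; apply: eq_bigr => i _; rewrite normCK mulrC. Qed.

Lemma vnorm2_ge0 x : 0 <= vnorm2 x.
Proof. by apply: sumr_ge0 => i _; rewrite exprn_ge0. Qed.

Lemma vnorm2_eq0 x : (vnorm2 x == 0) = (x == 0).
Proof.
rewrite /vnorm2 psumr_eq0; last by move=> i _; rewrite exprn_ge0.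
apply/allP/eqP => [x0|-> i _]; last by rewrite /= mxE normr0 expr0n.
apply/colP=> i; have := x0 i (mem_index_enum i).
by rewrite mxE /= expf_eq0 normr_eq0 => /eqP.
Qed.

Lemma vnorm2_gt0 x : (0 < vnorm2 x) = (x != 0).
Proof. by rewrite lt0r vnorm2_ge0 vnorm2_eq0 andbT. Qed.

Lemma vnorm20 : vnorm2 (0 : 'cV[C]_n) = 0.
Proof. by apply/eqP; rewrite vnorm2_eq0. Qed.

Lemma vnorm2D x y :
  vnorm2 (x + y) = vnorm2 x + (dot x y + dot y x) + vnorm2 y.
Proof. by rewrite !vnorm2E !dotDl !dotDr !addrA. Qed.

Lemma vnorm2Z a x : vnorm2 (a *: x) = `|a| ^+ 2 * vnorm2 x.
Proof. by rewrite !vnorm2E dotZl dotZr mulrA normCK [a^* * a]mulrC. Qed.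

Lemma dotr_inj x : (forall y, dot y x = 0) -> x = 0.
Proof. by move=> /(_ x) /eqP; rewrite -vnorm2E vnorm2_eq0 => /eqP. Qed.

Lemma cauchy_cross x y : - (vnorm2 x + vnorm2 y) <= dot x y + dot y x.
Proof.
have := vnorm2_ge0 (x + y); rewrite vnorm2D addrAC addrC => xy_ge0.
by rewrite -subr_ge0 opprK.
Qed.

Lemma hermitian_spectral A : A = dag A ->
  exists (U : 'M[C]_n) (d : 'rV[C]_n), [/\ dag U *m U = 1%:M, U *m dag U = 1%:M,
    forall i, d 0 i \is Num.real & A = U *m diag_mx d *m dag U].
Proof.
move=> hA.
have hermA : A \is hermsymmx.
  by rewrite is_hermitianmxE expr0 scale1r {1}hA /dag map_trmx.
have Un := spectral_unitarymx A; set P := spectralmx A in Un.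
have dagP : dag P = map_mx Num.conj P^T by rewrite /dag map_trmx.
have PV : P *m dag P = 1%:M by rewrite dagP; apply/unitarymxP.
exists (dag P), (spectral_diag A); split.
- by rewrite dagK.
- by rewrite dagK; apply: mulmx1C.
- by move=> i; have /mxOverP := hermitian_spectral_diag_real hermA; apply.
have /hermitian_normalmx/orthomx_spectralP {1}-> := hermA.
by rewrite -/P invmx_unitary // -dagP dagK.
Qed.

Lemma diag_form (U : 'M[C]_n) (d : 'rV[C]_n) x :
  dot x (U *m diag_mx d *m dag U *m x) = \sum_i d 0 i * `|(dag U *m x) i 0| ^+ 2.
Proof.
rewrite -!mulmxA dot_dagr dotE; apply: eq_bigr => i _.
by rewrite mul_diag_mx [in X in _ * X = _]mxE normCK mulrCA [_^* * _]mulrC.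
Qed.

Lemma isometry_vnorm2 (U : 'M[C]_n) x : dag U *m U = 1%:M -> vnorm2 (U *m x) = vnorm2 x.
Proof. by move=> UU; rewrite !vnorm2E dot_dagl mulmxA UU mul1mx. Qed.

Lemma diag_eigen (U : 'M[C]_n) (d : 'rV[C]_n) i : dag U *m U = 1%:M ->
  U *m diag_mx d *m dag U *m col i U = d 0 i *: col i U.
Proof.
move=> UU; rewrite !colE -!mulmxA [dag U *m _]mulmxA UU mul1mx scalemxAr.
congr (_ *m _); apply/colP=> j; rewrite mul_diag_mx !mxE eqxx andbT.
by case: eqP => [->|]; rewrite ?mulr0.
Qed.

Lemma isometry_col (U : 'M[C]_n) i : dag U *m U = 1%:M -> vnorm2 (col i U) = 1.
Proof.
move=> UU; rewrite colE isometry_vnorm2 // vnorm2E dotE (bigD1 i) //= big1 => [|j ji].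
  by rewrite !mxE !eqxx rmorph1 mulr1 addr0.
by rewrite !mxE (negPf ji) mulr0.
Qed.

(** In an eigenbasis the form is a combination of squared moduli with coefficients [d 0 i], so
    either some eigenvalue vanishes or all are bounded away from 0. *)
Lemma semidefinite_kernel_or_gap A : A = dag A -> (forall x, 0 <= dot x (A *m x)) ->
  (exists2 x, x != 0 & dot x (A *m x) = 0) \/
  (exists2 e : C, 0 < e & forall x, e * vnorm2 x <= dot x (A *m x)).
Proof.
move=> /hermitian_spectral [U [d [UU UV _ ->]]] Apos.
have dE i : dot (col i U) (U *m diag_mx d *m dag U *m col i U) = d 0 i.
  by rewrite diag_eigen // dotZr -vnorm2E isometry_col // mulr1.
have d_ge0 i : 0 <= d 0 i by rewrite -dE.
have [/forallP d_neq0|/forallPn [i /negPn/eqP di0]] := boolP [forall i, d 0 i != 0].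
  right; have d_gt0 i : 0 < d 0 i by rewrite lt0r d_neq0 d_ge0.
  (* [s^-1] lies below every eigenvalue, which avoids taking a minimum; the added 1 keeps [s]
     positive when [n] is 0. *)
  pose s := 1 + \sum_i (d 0 i)^-1.
  have s_gt0 : 0 < s.
    by rewrite ltr_pwDl ?ltr01 ?sumr_ge0 // => i _; rewrite invr_ge0 ltW.
  exists s^-1; first by rewrite invr_gt0.
  move=> x; rewrite diag_form -(@isometry_vnorm2 (dag U)) ?dagK // /vnorm2 mulr_sumr.
  apply: ler_sum => i _; rewrite ler_wpM2r ?exprn_ge0 //.
  rewrite -[leRHS]invrK lef_pV2 ?posrE ?invr_gt0 //.
  rewrite /s (bigD1 i) //= addrCA lerDl addr_ge0 ?ler01 ?sumr_ge0 // => j _.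
  by rewrite invr_ge0 ltW.
left; exists (col i U); last by rewrite dE.
by rewrite -vnorm2_gt0 isometry_col ?ltr01.
Qed.

(** [E] is the spectral projection for the eigenvalue 0; a nonnegative form vanishes only on vectors
    supported on the null eigenvectors. *)
Lemma kernel_projection A : A = dag A -> (forall x, 0 <= dot x (A *m x)) ->
  exists E : 'M[C]_n, [/\ E = dag E, E *m E = E, A *m E = 0 &
    forall x, dot x (A *m x) = 0 -> E *m x = x].
Proof.
move=> /hermitian_spectral [U [d [UU UV _ ->]]] Apos.
have d_ge0 i : 0 <= d 0 i.
  have := Apos (col i U).
  by rewrite diag_eigen // dotZr -vnorm2E isometry_col // mulr1.
pose p : 'rV[C]_n := \row_i (d 0 i == 0)%:R.
have diagM (q r : 'rV[C]_n) : diag_mx q *m diag_mx r = diag_mx (\row_i (q 0 i * r 0 i)).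
  by rewrite mulmx_diag; congr diag_mx; apply/rowP=> i; rewrite !mxE.
have conjM q r : (U *m diag_mx q *m dag U) *m (U *m diag_mx r *m dag U) =
    U *m diag_mx (\row_i (q 0 i * r 0 i)) *m dag U.
  by rewrite -diagM !mulmxA -[_ *m dag U *m U]mulmxA UU mulmx1.
exists (U *m diag_mx p *m dag U); split.
- rewrite !dagM dagK mulmxA; congr (_ *m _ *m _).
  apply/matrixP=> i j; rewrite dagE !mxE rmorphMn /= [j == i]eq_sym.
  by case: (i =P j) => [->|_]; rewrite ?mulr0n ?rmorph_nat.
- rewrite conjM; congr (_ *m diag_mx _ *m _); apply/rowP=> i; rewrite !mxE.
  by case: eqP; rewrite ?mulr0 ?mulr1.
- rewrite conjM (_ : \row_i _ = 0) ?raddf0 ?mulmx0 ?mul0mx //.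
  by apply/rowP=> i; rewrite !mxE; case: eqP => [->|]; rewrite ?mulr0 ?mul0r.
move=> x /eqP; rewrite diag_form psumr_eq0 => [/allP x0|i _]; last first.
  by rewrite mulr_ge0 ?exprn_ge0.
rewrite -[RHS]mul1mx -UV -!mulmxA; congr (_ *m _); apply/colP=> i.
rewrite mul_diag_mx mxE [p 0 i]mxE; case: eqP => [_|/eqP di]; first by rewrite mul1r.
have := x0 i (mem_index_enum i).
by rewrite /= mulf_eq0 (negPf di) expf_eq0 normr_eq0 => /eqP->; rewrite mulr0.
Qed.

End Dot.

Lemma prim_root_exists n : (n > 0)%N -> exists z : C, n.-primitive_root z.
Proof.
pose p : {poly C} := 'X^n - 1; have [r Dp] := closed_field_poly_normal p.
move=> n_gt0; rewrite (monicP _) ?monicXnsubC // scale1r in Dp.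
have rn1: all n.-unity_root r by apply/allP=> z; rewrite -root_prod_XsubC -Dp.
have sz_r: (n < (size r).+1)%N.
  by rewrite -(size_prod_XsubC r id) -Dp size_XnsubC.
have [|z] := hasP (has_prim_root n_gt0 rn1 _ sz_r); last by exists z.
by rewrite -separable_prod_XsubC -Dp separable_Xn_sub_1 // pnatr_eq0 -lt0n.
Qed.

Lemma sum_unity_root n (w : C) : w ^+ n = 1 -> w != 1 -> \sum_(b < n) w ^+ b = 0.
Proof.
move=> wn1 w1; have := subrX1 w n; rewrite wn1 subrr => /esym/eqP.
by rewrite mulf_eq0 subr_eq0 (negPf w1) => /eqP.
Qed.

End HermitianSpace.

(** * Operator norms and first order perturbation *)

Section OperatorNorm.
Variable C : numClosedFieldType.

Section Norm.
Variable n : nat.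
Implicit Types (x y z : 'cV[C]_n) (A B : 'M[C]_n).

(** Squared bounds turn comparisons of operator norms into inequalities polynomial in [t], without
    square roots. *)
Definition sqbounded A (a : C) := forall x, vnorm2 (A *m x) <= a * vnorm2 x.

Lemma gram_dag A : dag A *m A = dag (dag A *m A).
Proof. by rewrite dagM dagK. Qed.

Lemma dot_gram A x : dot x (dag A *m A *m x) = vnorm2 (A *m x).
Proof. by rewrite vnorm2E dot_dagl mulmxA. Qed.

Lemma opnorm_boundE A a : 0 <= a -> opnorm_bound A (sqrtC a) <-> sqbounded A a.
Proof. by move=> a0; rewrite /opnorm_bound sqrtCK sqrtC_ge0 a0; split=> [[]|]. Qed.

(** The norm is the square root of the largest eigenvalue of [dag A *m A]. Its existence lets the
    isometry hypothesis, stated for exact norms, be applied to bounds. *)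
Lemma opnorm_exists A : exists r, is_opnorm A r.
Proof.
have [U [d [UU UV d_real dE]]] := hermitian_spectral (gram_dag A).
have dcol i : vnorm2 (A *m col i U) = d 0 i.
  by rewrite -dot_gram dE diag_eigen // dotZr -vnorm2E isometry_col // mulr1.
have d_ge0 i : 0 <= d 0 i by rewrite -dcol vnorm2_ge0.
have [m [m0 md mE]] : exists m, [/\ 0 <= m, forall i, d 0 i <= m &
    m = 0 \/ exists i, m = d 0 i].
  suff [m [m0 md mE]] : exists m, [/\ 0 <= m, {in enum 'I_n, forall i, d 0 i <= m} &
      m = 0 \/ exists i, m = d 0 i].
    by exists m; split=> // i; apply: md; rewrite mem_enum.
  elim: (enum 'I_n) => [|i s [m [m0 md mE]]]; first by exists 0; split=> //; left.
  have [le_im|lt_mi] := real_leP (d_real i) (ger0_real m0).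
    by exists m; split=> // j; rewrite inE => /predU1P [->|/md].
  exists (d 0 i); split=> //; last by right; exists i.
  by move=> j; rewrite inE => /predU1P [->|/md /le_trans]; [|apply; apply: ltW].
have Am : sqbounded A m.
  move=> x; rewrite -dot_gram dE diag_form -(@isometry_vnorm2 _ _ (dag U)) ?dagK //.
  by rewrite /vnorm2 mulr_sumr; apply: ler_sum => i _; rewrite ler_wpM2r ?exprn_ge0.
exists (sqrtC m); split; first by apply/opnorm_boundE.
move=> c [c0 Ac]; case: mE => [->|[i mE]]; first by rewrite sqrtC0.
rewrite -(@ler_pXn2r _ 2) ?nnegrE ?sqrtC_ge0 // sqrtCK mE -dcol.
by have := Ac (col i U); rewrite isometry_col // mulr1.
Qed.

Lemma sqbounded_exists A : exists2 a, 0 <= a & sqbounded A a.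
Proof.
have [r [[r0 Ar] _]] := opnorm_exists A.
by exists (r ^+ 2); rewrite ?exprn_ge0.
Qed.

Lemma sqbounded_le_opnorm A B r a :
  is_opnorm A r -> is_opnorm B r -> 0 <= a -> sqbounded A a -> sqbounded B a.
Proof.
move=> [_ Ar] [[r0 Br] _] a0 /(opnorm_boundE _ a0) /Ar le_ra x.
apply: le_trans (Br x) _; rewrite ler_wpM2r ?vnorm2_ge0 //.
by rewrite -[a]sqrtCK ler_pXn2r ?nnegrE ?sqrtC_ge0.
Qed.

Lemma sqbounded_iff A B : (forall r, is_opnorm B r <-> is_opnorm A r) ->
  forall a, 0 <= a -> (sqbounded B a <-> sqbounded A a).
Proof.
move=> AB a a0; have [r Ar] := opnorm_exists A; have Br := (AB r).2 Ar.
split; [exact: sqbounded_le_opnorm Br Ar a0|exact: sqbounded_le_opnorm Ar Br a0].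
Qed.

End Norm.

(** The case [t = 1] shows that [g] is real; if it were negative, [t = - g / (M + 1)] would give
    [0 <= g / (M + 1)]. This replaces a limit [t -> 0]. *)
Lemma ge0_of_perturbation (g M : C) :
  0 <= M -> (forall t, 0 < t -> 0 <= g + t * M) -> 0 <= g.
Proof.
move=> M0 gt; have M1 : 0 < M + 1 by rewrite ltr_wpDl.
have g_real : g \is Num.real.
  by rewrite -[g](addrK (1 * M)) rpredB ?ger0_real ?mul1r // -[M]mul1r gt.
rewrite real_leNgt ?real0 //; apply/negP => g_lt0.
have /gt : 0 < - g / (M + 1) by rewrite divr_gt0 ?oppr_gt0.
have -> : g + - g / (M + 1) * M = g / (M + 1) by field; rewrite gt_eqF.
by rewrite pmulr_lge0 ?invr_gt0 // lt_geF.
Qed.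

Lemma projection_pythagoras n (E : 'M[C]_n) (x y : 'cV[C]_n) : E = dag E ->
  E *m x = x -> E *m y = 0 -> dot x y = 0 /\ dot y x = 0.
Proof.
move=> EE Ex Ey; have xy : dot x y = 0 by rewrite -Ex dot_dagl -EE Ey dot0r.
by split=> //; rewrite -dotC xy rmorph0.
Qed.

(* The substitution [x = k + s y], with [k] in the kernel
   of [P], [E y = 0] and [t = s ^ 2], makes [P + t B] equal to
   [t (E B E + P)] up to [O(s ^ 3)], where [E] projects onto the kernel. *)
Lemma pencil_kernel_or_gap n (P B : 'M[C]_n) (M : C) :
  P = dag P -> B = dag B -> 0 <= M ->
  (forall x, 0 <= dot x (P *m x)) ->
  (forall x, P *m x = 0 -> 0 <= dot x (B *m x)) ->
  (exists x, [/\ x != 0, P *m x = 0 & dot x (B *m x) = 0]) \/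
  (exists2 t, 0 < t &
     forall x, t ^+ 2 * M * vnorm2 x <= dot x (P *m x) + t * dot x (B *m x)).
Proof.
move=> PP BB M0 P_ge0 B_ge0.
have [E [EE Eid PE Eker]] := kernel_projection PP P_ge0.
pose H := E *m B *m E + P.
(* [E B E] sees only the kernel component [x] and [P] only the component [y], so there are no cross
   terms. *)
have HE x y : E *m x = x -> E *m y = 0 ->
    dot (x + y) (H *m (x + y)) = dot x (B *m x) + dot y (P *m y).
  move=> Ex Ey; have Px : P *m x = 0 by rewrite -Ex mulmxA PE mul0mx.
  rewrite /H mulmxDl !mulmxDr Px -!mulmxA Ex Ey !mulmx0 addr0 add0r.
  rewrite dotDl !dotDr [dot x (P *m y)]dot_dagr -PP Px dot0l addr0.
  by rewrite ![dot _ (E *m _)]dot_dagr -EE Ex Ey dot0l add0r.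
have Esplit (x : 'cV[C]_n) : [/\ E *m (E *m x) = E *m x, E *m (x - E *m x) = 0 &
    x = E *m x + (x - E *m x)].
  by split; rewrite ?mulmxBr ?mulmxA ?Eid ?subrr // addrC subrK.
have H_ge0 x : 0 <= dot x (H *m x).
  have [Ek Ey ->] := Esplit x; rewrite HE // addr_ge0 // B_ge0 //.
  by rewrite mulmxA PE mul0mx.
have HH : H = dag H by rewrite /H dagD !dagM -EE -BB -PP mulmxA.
have [[x x0 Hx]|[e e0 He]] := semidefinite_kernel_or_gap HH H_ge0; [left|right].
  (* A null vector of [H] makes both nonnegative summands vanish; its second component [y] then
     satisfies [y = E y = 0]. *)
  have [Ek Ey xE] := Esplit x; move: Hx; rewrite xE HE //.
  have Pk : P *m (E *m x) = 0 by rewrite mulmxA PE mul0mx.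
  move=> /eqP; rewrite paddr_eq0 ?B_ge0 // => /andP [/eqP Bk /eqP /Eker].
  rewrite Ey => /esym y0; rewrite y0 addr0 in xE.
  by exists x; rewrite xE; split=> //; rewrite -xE.
have [L L0 BL] := sqbounded_exists B.
(* [c] collects the constants of the error terms, and [s = e / (e + c)] ensures [s <= 1] and
   [s * c <= e]. *)
pose c := M + (1 + L) *+ 2.
have L1 : 0 < 1 + L by rewrite ltr_pwDl ?ltr01.
have c0 : 0 < c by rewrite ltr_wpDl // pmulrn_lgt0.
pose s := e / (e + c); have ec0 : 0 < e + c by rewrite addr_gt0.
have s0 : 0 < s by rewrite divr_gt0.
have s1 : 0 <= 1 - s.
  by rewrite subr_ge0 ler_pdivrMr // mul1r lerDl ltW.
have sc : 0 <= e - s * c.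
  by rewrite subr_ge0 /s mulrAC ler_pdivrMr // ler_wpM2l ?(ltW e0) // lerDr ltW.
exists (s ^+ 2); first by rewrite exprn_gt0.
move=> x; have [Ek Ey0 xE] := Esplit x.
set k := E *m x in Ek xE; pose y := s^-1 *: (x - k).
have Ey : E *m y = 0 by rewrite -scalemxAr Ey0 scaler0.
have {}xE : x = k + s *: y by rewrite scalerA divff ?gt_eqF // scale1r addrC subrK.
have Pk : P *m k = 0 by rewrite -Ek mulmxA PE mul0mx.
have ss : s^* = s by apply/CrealP; rewrite gtr0_real.
have [ky yk] := projection_pythagoras EE Ek Ey.
rewrite {}xE; clearbody k y; clear x Ey0.
have -> : dot (k + s *: y) (P *m (k + s *: y)) = s ^+ 2 * dot y (P *m y).
  rewrite mulmxDr Pk add0r -scalemxAr dotZr dotDl dotZl [dot k _]dot_dagr -PP Pk.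
  by rewrite dot0l add0r ss; ring.
have -> : vnorm2 (k + s *: y) = vnorm2 k + s ^+ 2 * vnorm2 y.
  by rewrite vnorm2D dotZr dotZl ky yk !mulr0 !addr0 vnorm2Z gtr0_norm.
have -> : dot (k + s *: y) (B *m (k + s *: y)) =
    dot k (B *m k) + s * (dot (B *m k) y + dot y (B *m k)) + s ^+ 2 * dot y (B *m y).
  rewrite mulmxDr -scalemxAr !dotDl !dotDr !dotZl !dotZr ss.
  by rewrite [dot k (B *m y)]dot_dagr -BB; ring.
have := He (k + y); rewrite HE // vnorm2D ky yk !addr0.
set a := dot k _; set b := dot y (P *m y) => le_gap.
have := le_trans _ (cauchy_cross (B *m k) y).
move=> /(_ (- (L * vnorm2 k + vnorm2 y))); rewrite lerN2 lerD2r BL => /(_ isT).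
set r := dot _ y + _ => le_cross.
have cross : 0 <= r + (L * vnorm2 k + vnorm2 y) by move: le_cross; rewrite -subr_ge0 opprK.
have yBy : 0 <= (dot y (B *m y) + (1 + L) * vnorm2 y).
  have q2 : 0 <= dot y (B *m y) *+ 2 + (L * vnorm2 y + vnorm2 y).
    have := le_trans _ (cauchy_cross (B *m y) y).
    move=> /(_ (- (L * vnorm2 y + vnorm2 y))); rewrite lerN2 lerD2r BL => /(_ isT).
    by rewrite -subr_ge0 opprK dot_dagl -BB mulr2n.
  rewrite -(pmulrn_lge0 _ (isT : (0 < 2)%N)).
  have -> : (dot y (B *m y) + (1 + L) * vnorm2 y) *+ 2 =
    dot y (B *m y) *+ 2 + (L * vnorm2 y + vnorm2 y) + (1 + L) * vnorm2 y by ring.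
  by rewrite addr_ge0 // mulr_ge0 ?vnorm2_ge0 ?ltW.
set q := dot y (B *m y) in yBy *.
move: (vnorm2_ge0 k) (vnorm2_ge0 y) le_gap cross yBy.
set u := vnorm2 k; set w := vnorm2 y => u0 w0 le_gap cross yBy.
have gap : 0 <= a + b - e * (u + w) by rewrite subr_ge0.
rewrite -subr_ge0; set lhs := (X in 0 <= X).
(* A certificate of positivity: every summand is nonnegative by the gap of [H], the two lower bounds
   [cross] and [yBy], or [0 <= s <= 1] and [s * c <= e]. *)
have -> : lhs = s ^+ 2 * ((a + b - e * (u + w)) + s * (r + (L * u + w))
    + s ^+ 2 * (q + (1 + L) * w) + (e - s * c) * (u + w)
    + s * (M * ((1 - s) * u + (1 - s) * (1 + s + s ^+ 2) * w)
           + (u + L * w) + (1 + L) * (u + (1 - s) * w))).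
  by rewrite /lhs /c; ring.
have [s0' L1'] := (ltW s0, ltW L1).
have h : 0 <= 1 + s + s ^+ 2 by rewrite !addr_ge0 ?exprn_ge0.
apply: mulr_ge0; first exact: exprn_ge0.
have t1 := mulr_ge0 s0' cross.
have t2 := mulr_ge0 (exprn_ge0 2 s0') yBy.
have t3 := mulr_ge0 sc (addr_ge0 u0 w0).
apply: (addr_ge0 (addr_ge0 (addr_ge0 (addr_ge0 gap t1) t2) t3)).
apply: mulr_ge0 => //; apply: addr_ge0; last first.
  by rewrite mulr_ge0 // addr_ge0 // mulr_ge0.
apply: addr_ge0; last by rewrite addr_ge0 // mulr_ge0.
by rewrite mulr_ge0 // addr_ge0 // !mulr_ge0.
Qed.

End OperatorNorm.

(** * The Toeplitz algebra *)

Section ToeplitzAlgebra.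
Variable C : numClosedFieldType.

Section Toeplitz.
Variable n : nat.
Implicit Types A B : 'M[C]_n.
Local Notation S := (jordanS C n).

Lemma jordanS_expE k (i j : 'I_n) : (S ^+ k) i j = (j == (i + k)%N :> nat)%:R.
Proof.
elim: k i j => [|k IHk] i j; first by rewrite expr0 addn0 mxE eq_sym.
rewrite exprS -mulmxE mxE; have [lt_in|le_ni] := ltnP i.+1 n.
  rewrite (bigD1 (Ordinal lt_in)) //= big1 => [|l li].
    by rewrite IHk mxE eqxx mul1r addr0 addnS.
  by rewrite mxE (_ : (_ == _) = false) ?mul0r //; apply: contraNF li => /eqP li; apply/eqP/val_inj.
rewrite big1 => [|l _]; last first.
  by rewrite mxE ltn_eqF ?mul0r // (leq_trans (ltn_ord l)).
by rewrite addnS ltn_eqF // (leq_trans (ltn_ord j)) // (leq_trans le_ni) // ltnS leq_addr.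
Qed.

Lemma jordanS_nilpotent : S ^+ n = 0.
Proof.
apply/matrixP=> i j; rewrite jordanS_expE mxE ltn_eqF //.
by rewrite (leq_trans (ltn_ord j)) ?leq_addl.
Qed.

Lemma poly_at_mx_wide N (p : {poly C}) A : (size p <= N)%N ->
  poly_at_mx p A = \sum_(k < N) p`_k *: A ^+ k.
Proof.
move=> le_pN; rewrite /poly_at_mx (big_ord_widen N (fun k => p`_k *: A ^+ k)) //.
rewrite big_mkcond; apply: eq_bigr => k _; case: ltnP => // le_pk.
by rewrite nth_default ?scale0r.
Qed.

Lemma in_toeplitz_lin a A B : in_toeplitz A -> in_toeplitz B -> in_toeplitz (a *: A + B).
Proof.
move=> [p ->] [q ->]; exists (a *: p + q).
pose N := maxn (size p) (size q).
rewrite !(@poly_at_mx_wide N) ?leq_maxl ?leq_maxr //.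
  rewrite scaler_sumr -big_split; apply: eq_bigr => k _ /=.
  by rewrite coefD coefZ scalerDl scalerA.
rewrite (leq_trans (size_polyD _ _)) // geq_max leq_maxr andbT.
by rewrite (leq_trans (size_scale_leq _ _)) ?leq_maxl.
Qed.

Lemma in_toeplitz_exp k : in_toeplitz (S ^+ k).
Proof.
exists 'X^k; rewrite (@poly_at_mx_wide k.+1) ?size_polyXn //.
rewrite (bigD1 ord_max) //= big1 ?addr0 ?coefXn ?eqxx ?scale1r // => i.
by rewrite -val_eqE /= coefXn => /negPf ->; rewrite scale0r.
Qed.

Lemma in_toeplitz0 : in_toeplitz (0 : 'M[C]_n).
Proof. by exists 0; rewrite (@poly_at_mx_wide 0) ?size_poly0 // big_ord0. Qed.

Lemma in_toeplitz_sum m (a : nat -> C) : in_toeplitz (\sum_(k < m) a k *: S ^+ k).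
Proof.
elim: m => [|m IHm]; first by rewrite big_ord0; apply: in_toeplitz0.
rewrite big_ord_recr /= addrC; apply: in_toeplitz_lin => //; exact: in_toeplitz_exp.
Qed.

(* Chosen so that, for [|k| = 1], [toep_half k + (toep_half k)^*] has entries [k^(i-j)]. *)
Definition half_coef (k : C) (j : nat) : C := if j == 0%N then 2^-1 else k^-1 ^+ j.
Definition toep_half (k : C) : 'M[C]_n := \sum_(j < n) half_coef k j *: S ^+ j.
Definition geom_vec (k : C) : 'cV[C]_n := \col_i k ^+ i.

Lemma toep_halfE k i j :
  toep_half k i j = if (i <= j)%N then half_coef k (j - i) else 0.
Proof.
rewrite summxE; case: leqP => [le_ij|lt_ji].
  have lt_n : (j - i < n)%N by rewrite (leq_ltn_trans (leq_subr _ _)).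
  rewrite (bigD1 (Ordinal lt_n)) //= big1 ?addr0.
    by rewrite mxE jordanS_expE subnKC // eqxx mulr1.
  move=> l /negPf nl; rewrite mxE jordanS_expE (_ : _ == _ = false) ?mulr0 //.
  by apply: contraFF nl => /eqP jil; rewrite -val_eqE /= jil addKn.
by rewrite big1 // => l _; rewrite mxE jordanS_expE ltn_eqF ?mulr0 // ltn_addr.
Qed.

Lemma norm1_conj (k : C) : `|k| = 1 -> k^* = k^-1.
Proof. by move=> k1; rewrite [RHS]invC_norm k1 expr1n invr1 mul1r. Qed.

(** Conjugation inverts [k], so the entries [k^(i-j)] factor and the sum is the rank one matrix
    [geom_vec k *m dag (geom_vec k)]. *)
Lemma toep_half_re k (x : 'cV[C]_n) : `|k| = 1 ->
  (toep_half k + dag (toep_half k)) *m x = dot (geom_vec k) x *: geom_vec k.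
Proof.
move=> k1; have k0 : k != 0 by rewrite -normr_eq0 k1 oner_eq0.
have -> : toep_half k + dag (toep_half k) = geom_vec k *m dag (geom_vec k).
  apply/matrixP=> i j; rewrite mxE dagE !toep_halfE [RHS]mxE big_ord1 dagE !mxE.
  rewrite rmorphXn /= (norm1_conj k1) /half_coef.
  have [ij|ji|/val_inj ij] := ltngtP i j.
  - rewrite conjC0 addr0 subn_eq0 leqNgt ij /= -{2}(subnK (ltnW ij)) exprD.
    by rewrite mulrCA -exprMn divff // expr1n mulr1.
  - rewrite add0r subn_eq0 leqNgt ji /= rmorphXn fmorphV /= (norm1_conj k1) invrK.
    by rewrite -{2}(subnK (ltnW ji)) exprD -mulrA -exprMn divff // expr1n mulr1.
  rewrite ij subnn /= -exprMn divff // expr1n fmorphV rmorph_nat.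
  by field.
rewrite -mulmxA; apply/colP=> i.
by rewrite mxE big_ord1 [RHS]mxE mulrC.
Qed.

Lemma vnorm2_geom_vec k : `|k| = 1 -> vnorm2 (geom_vec k) = n%:R.
Proof.
move=> k1; rewrite /vnorm2 (eq_bigr (fun=> 1)) ?sumr_const ?card_ord // => i _.
by rewrite mxE normrX k1 !expr1n.
Qed.

End Toeplitz.

Lemma vnorm2_pencil n (X Z : 'M[C]_n) t (x : 'cV[C]_n) : t \is Num.real ->
  vnorm2 ((X + t *: Z) *m x) = vnorm2 (X *m x)
    + t * dot x ((dag X *m Z + dag Z *m X) *m x) + t ^+ 2 * vnorm2 (Z *m x).
Proof.
move=> /CrealP tt; rewrite [(X + _) *m x]mulmxDl -scalemxAl vnorm2D !dotZr !dotZl vnorm2Z.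
rewrite -normrX ger0_norm ?real_exprn_even_ge0 //; last exact/CrealP.
rewrite tt mulmxDl dotDr -!mulmxA ![dot x (dag _ *m _)]dot_dagr !dagK.
by ring.
Qed.

(** Testing the form at [x - t c y] with [c = dot y (G *m x)] gives [- 2 t |c|^2 + O(t^2) >= 0],
    which forces [c = 0]. The predicate [V] admits forms that are nonnegative only on a subspace. *)
Lemma semidefinite_null n (G : 'M[C]_n) (V : 'cV[C]_n -> Prop) (x y : 'cV[C]_n) :
  G = dag G -> (forall a, V (x + a *: y)) -> (forall z, V z -> 0 <= dot z (G *m z)) ->
  0 <= dot y (G *m y) -> dot x (G *m x) = 0 -> dot y (G *m x) = 0.
Proof.
move=> GG Vxy G_ge0 yGy xGx; set c := dot y (G *m x).
suff : 0 <= - (`|c| ^+ 2 *+ 2).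
  rewrite oppr_ge0 pmulrn_lle0 // => c_le0.
  have : `|c| ^+ 2 == 0 by rewrite eq_le c_le0 exprn_ge0.
  by rewrite expf_eq0 normr_eq0 => /eqP.
apply: (@ge0_of_perturbation _ _ (`|c| ^+ 2 * dot y (G *m y))).
  by rewrite mulr_ge0 ?exprn_ge0.
move=> t t0; have tt : t^* = t by apply/CrealP; rewrite gtr0_real.
have := G_ge0 _ (Vxy (- t * c)).
rewrite mulmxDr -scalemxAr !dotDl !dotDr !dotZl !dotZr xGx -/c.
have -> : dot x (G *m y) = c^* by rewrite /c dotC dot_dagl -GG.
rewrite rmorphM rmorphN /= tt => h.
rewrite -(pmulr_rge0 _ t0); move: h; congr (0 <= _).
by rewrite normCK; ring.
Qed.

End ToeplitzAlgebra.

(** * Isometries of the Toeplitz algebra *)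

Section ToeplitzIsometry.
Variables (C : numClosedFieldType) (n : nat) (phi : 'M[C]_n -> 'M[C]_n).
Hypothesis n_gt0 : (0 < n)%N.
Hypothesis phi_lin : forall (a : C) (A B : 'M[C]_n), in_toeplitz A -> in_toeplitz B ->
  phi (a *: A + B) = a *: phi A + phi B.
Hypothesis phi_sqbounded : forall (A : 'M[C]_n) a, in_toeplitz A -> 0 <= a ->
  (sqbounded (phi A) a <-> sqbounded A a).
Local Notation S := (jordanS C n).
Local Notation X := (phi 1%:M).

Lemma phi0 : phi 0 = 0.
Proof.
have := phi_lin (-1) (in_toeplitz0 C n) (in_toeplitz0 C n).
by rewrite scaler0 addr0 scaleN1r addNr.
Qed.

Lemma phi_sum m (a : nat -> C) :
  phi (\sum_(k < m) a k *: S ^+ k) = \sum_(k < m) a k *: phi (S ^+ k).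
Proof.
elim: m => [|m IHm]; first by rewrite !big_ord0 phi0.
rewrite !big_ord_recr /= addrC phi_lin ?IHm 1?addrC //; first exact: in_toeplitz_exp.
exact: in_toeplitz_sum.
Qed.

Lemma in_toeplitz1 : in_toeplitz (1%:M : 'M[C]_n).
Proof. exact: (in_toeplitz_exp C n 0). Qed.

Lemma phi_pencil t A : in_toeplitz A -> phi (1%:M + t *: A) = X + t *: phi A.
Proof. by move=> tA; rewrite addrC phi_lin 1?addrC //; exact: in_toeplitz1. Qed.

(** * First order norm comparison on the kernel of the defect *)

Let P := 1%:M - dag X *m X.

Lemma defect_dag : P = dag P.
Proof. by rewrite /P dagD dagN dagM dagK dag1. Qed.

Lemma defect_dot x : dot x (P *m x) = vnorm2 x - vnorm2 (X *m x).
Proof. by rewrite mulmxBl mul1mx dotDr dotNr dot_gram !vnorm2E. Qed.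

Lemma defect_ge0 x : 0 <= dot x (P *m x).
Proof.
rewrite defect_dot subr_ge0 -[leRHS]mul1r.
apply: ((phi_sqbounded in_toeplitz1 ler01).2 _ x).
by move=> y; rewrite mul1mx mul1r.
Qed.

Lemma defect_ker (x : 'cV[C]_n) : P *m x = 0 -> dag X *m X *m x = x.
Proof. by rewrite mulmxBl mul1mx => /subr0_eq. Qed.

Lemma defect_ker_norm (x : 'cV[C]_n) : P *m x = 0 -> vnorm2 (X *m x) = vnorm2 x.
Proof. by move=> /defect_ker Px; rewrite -dot_gram Px vnorm2E. Qed.

(** As [A + dag A] is nonnegative, [1 - t A] has squared norm at most [1 + t^2 M]. The same bound
    for [X - t phi A], at a vector whose norm [X] preserves, gives the claim after division by [t]
    and [t -> 0]. *)
Lemma phi_re_ge0 A x : in_toeplitz A -> (forall y, 0 <= dot y ((A + dag A) *m y)) ->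
  P *m x = 0 -> 0 <= dot x ((dag X *m phi A + dag (phi A) *m X) *m x).
Proof.
move=> tA A_ge0 Px; have [M M0 AM] := sqbounded_exists A.
apply: (@ge0_of_perturbation _ _ (M * vnorm2 x)); first by rewrite mulr_ge0 ?vnorm2_ge0.
move=> t t0; have t_real : - t \is Num.real by rewrite rpredN gtr0_real.
have bound : sqbounded (1%:M + (- t) *: A) (1 + t ^+ 2 * M).
  move=> y; rewrite vnorm2_pencil // mul1mx dag1 mul1mx mulmx1 sqrrN mulrDl mul1r.
  rewrite lerD // ?gerDl -?mulrA ?ler_wpM2l ?exprn_ge0 ?(ltW t0) //.
  by rewrite mulNr oppr_le0 mulr_ge0 // ltW.
have tB : in_toeplitz (1%:M + (- t) *: A).
  by rewrite addrC; apply: in_toeplitz_lin => //; exact: in_toeplitz1.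
have b_ge0 : 0 <= 1 + t ^+ 2 * M by rewrite addr_ge0 // mulr_ge0 // exprn_ge0 // ltW.
have /(_ x) := (phi_sqbounded tB b_ge0).2 bound.
rewrite phi_pencil // vnorm2_pencil // defect_ker_norm // -subr_ge0.
set g := dot x _; set v := vnorm2 x; set w := vnorm2 _ => h.
rewrite -(pmulr_rge0 _ t0).
have -> : t * (g + t * (M * v)) =
  ((1 + t ^+ 2 * M) * v - (v + - t * g + (- t) ^+ 2 * w)) + t ^+ 2 * w by ring.
by rewrite addr_ge0 // mulr_ge0 ?vnorm2_ge0 // exprn_ge0 // ltW.
Qed.

Let Z k := phi (toep_half n k).
Let G k := dag X *m Z k + dag (Z k) *m X.

Lemma dagG k : G k = dag (G k).
Proof. by rewrite /G dagD !dagM !dagK addrC. Qed.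

Lemma toep_half_toeplitz (k : C) : in_toeplitz (toep_half n k).
Proof. exact: in_toeplitz_sum. Qed.

Lemma G_ge0 k x : `|k| = 1 -> P *m x = 0 -> 0 <= dot x (G k *m x).
Proof.
move=> k1; apply: phi_re_ge0 (toep_half_toeplitz k) _ => y.
rewrite toep_half_re // dotZr -dotC mulrC -normCK.
by rewrite exprn_ge0.
Qed.

Let Y r := dag X *m phi (S ^+ r).

Lemma dagY0 : dag (Y 0) = Y 0.
Proof. by rewrite /Y expr0 dagM dagK. Qed.

Lemma Yn : Y n = 0.
Proof. by rewrite /Y jordanS_nilpotent phi0 mulmx0. Qed.

(** The two halves of the constant term add up to the Hermitian [Y 0]. Since [Y n = 0], the second
    sum may run up to index [n]. *)
Lemma GE k : `|k| = 1 ->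
  G k = \sum_(j < n) k^-1 ^+ j *: Y j + \sum_(j < n) k ^+ j.+1 *: dag (Y j.+1).
Proof.
move=> k1; rewrite /G /Z /toep_half phi_sum.
have -> : dag X *m (\sum_(j < n) half_coef k j *: phi (S ^+ j)) =
    \sum_(j < n) half_coef k j *: Y j.
  by rewrite mulmx_sumr; apply: eq_bigr => j _; rewrite -scalemxAr.
have -> : dag (\sum_(j < n) half_coef k j *: phi (S ^+ j)) *m X =
    \sum_(j < n) (half_coef k j)^* *: dag (Y j).
  rewrite dag_sum mulmx_suml; apply: eq_bigr => j _.
  by rewrite dagZ -scalemxAl /Y dagM dagK.
(* The length of the sums is separated from the matrix size, so that it can be split as a
   successor. *)
suff aux N : N = n ->
    \sum_(j < N) half_coef k j *: Y j + \sum_(j < N) (half_coef k j)^* *: dag (Y j)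
    = \sum_(j < N) k^-1 ^+ j *: Y j + \sum_(j < N) k ^+ j.+1 *: dag (Y j.+1) by exact: aux.
case: N => [nE|m nE]; first by have := n_gt0; rewrite -{1}nE.
have Ym : Y m.+1 = 0 by rewrite nE Yn.
rewrite [in RHS]big_ord_recl [X in _ = _ + X]big_ord_recr /= Ym dag0 scaler0 addr0.
rewrite !big_ord_recl /half_coef /= dagY0 fmorphV rmorph_nat addrACA.
rewrite -scalerDl expr0 (_ : 2^-1 + 2^-1 = 1) ?addrA; last by field.
congr (_ + _ + _); apply: eq_bigr => j _.
by rewrite rmorphXn fmorphV /= (norm1_conj k1) invrK.
Qed.

(** * Averaging over the n-th roots of unity *)

Section Roots.
Variable w : C.
Hypothesis w_prim : n.-primitive_root w.

Lemma norm_root_unity b : `|w ^+ b| = 1.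
Proof.
have : `|w| ^+ n == 1 by rewrite -normrX (prim_expr_order w_prim) normr1.
by rewrite pexpr_eq1 // => /eqP w1; rewrite normrX w1 expr1n.
Qed.

Lemma sum_prim_root_exp j : \sum_(b < n) (w ^+ j) ^+ b = if (n %| j)%N then n%:R else 0.
Proof.
rewrite (prim_order_dvd w_prim); case: eqP => wj.
  rewrite wj (eq_bigr (fun=> 1)) ?sumr_const ?card_ord // => b _.
  by rewrite expr1n.
by apply: sum_unity_root; [rewrite exprAC (prim_expr_order w_prim) expr1n|exact/eqP].
Qed.

(** Orthogonality of characters keeps one index in each sum of [GE]: [j = r] in the first and
    [j + 1 = n - r] in the second. *)
Lemma G_fourier k r : `|k| = 1 -> (r < n)%N ->
  \sum_(b < n) (w ^+ r) ^+ b *: G (k * w ^+ b) =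
  (n%:R * k^-1 ^+ r) *: (Y r + k ^+ n *: dag (Y (n - r))).
Proof.
move=> k1 rn; have k0 : k != 0 by rewrite -normr_eq0 k1 oner_eq0.
have w0 : w != 0 by rewrite (prim_root_eq0 w_prim) -lt0n.
under eq_bigr do rewrite GE ?normrM ?norm_root_unity ?k1 ?mulr1 // scalerDr !scaler_sumr.
rewrite big_split /= exchange_big /= [X in _ + X]exchange_big /= scalerDr.
congr (_ + _).
  rewrite (bigD1 (Ordinal rn)) //= [X in _ + X]big1 ?addr0 => [|j jr].
    under eq_bigr do rewrite scalerA.
    rewrite -scaler_suml; congr (_ *: _).
    rewrite (eq_bigr (fun=> k^-1 ^+ r)) => [|b _].
      by rewrite sumr_const card_ord mulr_natl.
    rewrite invfM exprMn mulrCA [(w ^+ b)^-1 ^+ r]exprVn exprAC divff ?mulr1 //.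
    by rewrite !expf_neq0.
  under eq_bigr do rewrite scalerA.
  rewrite -scaler_suml.
  (* Since [w ^+ n = 1], the negative exponent [- j] is replaced by [n - j]. *)
  have -> : \sum_(b < n) (w ^+ r) ^+ b * (k * w ^+ b)^-1 ^+ j =
      k^-1 ^+ j * \sum_(b < n) (w ^+ (r + (n - j))) ^+ b.
    rewrite mulr_sumr; apply: eq_bigr => b _.
    rewrite invfM exprMn mulrCA; congr (_ * _).
    rewrite exprD exprMn; congr (_ * _); rewrite exprVn -exprM.
    apply: (mulIf (_ : w ^+ (b * j) != 0)); first by rewrite expf_neq0.
    rewrite mulVf ?expf_neq0 // -exprM [(b * j)%N]mulnC -exprD -mulnDl.
    by rewrite subnK ?(ltnW (ltn_ord j)) // exprM (prim_expr_order w_prim) expr1n.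
  rewrite sum_prim_root_exp ifN ?mulr0 ?scale0r // addnBA ?(ltnW (ltn_ord j)) //.
  rewrite -eqn_mod_dvd ?ltn_addl //; last by rewrite (leq_trans (ltnW (ltn_ord j))) ?leq_addl.
  by rewrite modnDr !modn_small ?ltn_ord // eq_sym.
have lt_n : (n - r.+1 < n)%N by rewrite ltn_subrL n_gt0.
have nr : (n - r.+1).+1 = (n - r)%N by rewrite subnSK.
rewrite (bigD1 (Ordinal lt_n)) //= [X in _ + X]big1 ?addr0 => [|j jr].
  under eq_bigr do rewrite scalerA.
  rewrite -scaler_suml nr scalerA; congr (_ *: _).
  rewrite (eq_bigr (fun=> k^-1 ^+ r * k ^+ n)) => [|b _].
    by rewrite sumr_const card_ord -[LHS]mulr_natl mulrA.
  rewrite exprMn -exprM [(r * b)%N]mulnC exprM mulrCA -exprD subnKC 1?ltnW //.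
  rewrite exprAC (prim_expr_order w_prim) expr1n mulr1.
  rewrite -{2}(subnK (ltnW rn)) exprD mulrCA -exprMn mulVf //.
  by rewrite expr1n mulr1.
under eq_bigr do rewrite scalerA.
rewrite -scaler_suml.
have -> : \sum_(b < n) (w ^+ r) ^+ b * (k * w ^+ b) ^+ j.+1 =
    k ^+ j.+1 * \sum_(b < n) (w ^+ (r + j.+1)) ^+ b.
  rewrite mulr_sumr; apply: eq_bigr => b _.
  by rewrite exprMn mulrCA [w ^+ (r + _)]exprD [in RHS]exprMn [(w ^+ b) ^+ _]exprAC.
rewrite sum_prim_root_exp ifN ?mulr0 ?scale0r //.
apply: contra jr => /dvdnP [q qE]; apply/eqP/val_inj => /=.
(* The exponent [r + j.+1] lies strictly between 0 and [2 n], so a multiple of [n] can only be [n]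
   itself. *)
have lt_q2 : (q * n < 2 * n)%N by rewrite -qE mul2n -addnn -addSn leq_add.
have q1 : q = 1%N.
  move: lt_q2 qE; rewrite ltn_pmul2r //; case: q => [|[|//]] // _.
  by rewrite addnS.
by rewrite -[in RHS](mul1n n) -q1 -qE addnS subSS addKn.
Qed.

Lemma G_sum k : `|k| = 1 -> \sum_(b < n) G (k * w ^+ b) = n%:R *: (dag X *m X).
Proof.
move=> k1; have := G_fourier k1 n_gt0.
rewrite subn0 Yn dag0 scaler0 addr0 mulr1 /Y expr0 => <-.
by apply: eq_bigr => b _; rewrite expr1n scale1r.
Qed.

Lemma G_sum_dot k x : `|k| = 1 -> P *m x = 0 ->
  \sum_(b < n) dot x (G (k * w ^+ b) *m x) = n%:R * vnorm2 x.
Proof.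
move=> k1 Px; rewrite -dot_sumr -mulmx_suml G_sum // -scalemxAl dotZr.
by rewrite defect_ker // vnorm2E.
Qed.

Lemma norm_mul_root k b : `|k| = 1 -> `|k * w ^+ b| = 1.
Proof. by move=> k1; rewrite normrM k1 norm_root_unity mulr1. Qed.

Lemma G_le k x : `|k| = 1 -> P *m x = 0 -> dot x (G k *m x) <= n%:R * vnorm2 x.
Proof.
move=> k1 Px; rewrite -(G_sum_dot k1 Px) (bigD1 (Ordinal n_gt0)) //= expr0 mulr1 lerDl.
by apply: sumr_ge0 => b _; rewrite G_ge0 ?norm_mul_root.
Qed.

(** Otherwise the gap for [P + t B] bounds the squared norm of [X + t Z k], hence of [1 + t f] with
    [f = toep_half n k], by [1 + t n]. At [v = geom_vec n k] the terms up to first order already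
    reach this bound, so [f v = 0], contradicting the value of [f + dag f] at [v]. *)
Lemma G_attains k : `|k| = 1 ->
  exists x, [/\ x != 0, P *m x = 0 & dot x (G k *m x) = n%:R * vnorm2 x].
Proof.
move=> k1; pose B := n%:R *: 1%:M - G k.
have B_dot x : dot x (B *m x) = n%:R * vnorm2 x - dot x (G k *m x).
  by rewrite mulmxBl -scalemxAl mul1mx dotDr dotNr dotZr vnorm2E.
have BB : B = dag B by rewrite /B dagD dagN dagZ dag1 -dagG rmorph_nat.
have [M M0 ZM] := sqbounded_exists (Z k).
have B_ge0 x : P *m x = 0 -> 0 <= dot x (B *m x).
  by move=> Px; rewrite B_dot subr_ge0 G_le.
have [[x [x0 Px Bx]]|[t t0 gap]] := pencil_kernel_or_gap defect_dag BB M0 defect_ge0 B_ge0.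
  exists x; split=> //; apply/esym/eqP; rewrite -subr_eq0 -B_dot; exact/eqP.
exfalso.
have tH := toep_half_toeplitz k.
have a_ge0 : 0 <= 1 + t * n%:R by rewrite addr_ge0 // mulr_ge0 ?ler0n // ltW.
have tB : in_toeplitz (1%:M + t *: toep_half n k).
  by rewrite addrC; apply: in_toeplitz_lin => //; exact: in_toeplitz1.
have bound : sqbounded (phi (1%:M + t *: toep_half n k)) (1 + t * n%:R).
  move=> x; rewrite phi_pencil // vnorm2_pencil ?gtr0_real // -subr_ge0.
  have := gap x; rewrite defect_dot B_dot -subr_ge0 => gx.
  have zx : 0 <= t ^+ 2 * (M * vnorm2 x - vnorm2 (Z k *m x)).
    by apply: mulr_ge0; [apply: exprn_ge0; apply: ltW|rewrite subr_ge0].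
  have := addr_ge0 gx zx; congr (0 <= _); rewrite -/(G k); ring.
have /(_ (geom_vec n k)) := (phi_sqbounded tB a_ge0).1 bound.
set v := geom_vec n k.
have vv : dot v v = n%:R by rewrite -vnorm2E vnorm2_geom_vec.
rewrite vnorm2_pencil ?gtr0_real // mul1mx dag1 mul1mx mulmx1 toep_half_re // dotZr.
rewrite [vnorm2 v]vnorm2E vv -subr_ge0.
set f := vnorm2 _ => bound_v.
have Fv : f <= 0.
  rewrite -oppr_ge0 -(pmulr_rge0 _ (exprn_gt0 2 t0)); move: bound_v; congr (0 <= _).
  by ring.
have /eqP : vnorm2 (toep_half n k *m v) = 0 by apply/eqP; rewrite eq_le Fv vnorm2_ge0.
rewrite vnorm2_eq0 => /eqP {}Fv.
have : dot v ((toep_half n k + dag (toep_half n k)) *m v) = 0.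
  by rewrite mulmxDl dotDr Fv dot0r dot_dagr dagK Fv dot0l addr0.
rewrite toep_half_re // dotZr vv => /eqP.
by rewrite mulf_eq0 orbb pnatr_eq0 eqn0Ngt n_gt0.
Qed.

(* The [x b] maximize the form [G (k * w ^+ b)] on the unit sphere of [ker P]; as the
   forms are nonnegative with sum [n], the other ones then vanish at [x b]. *)
Definition peaks k (x : 'I_n -> 'cV[C]_n) := forall b, [/\ x b != 0, P *m x b = 0 &
  forall (c : 'I_n) y, P *m y = 0 ->
    dot y (G (k * w ^+ c) *m x b) = if c == b then n%:R * dot y (x b) else 0].

Lemma peaks_exist k : `|k| = 1 -> exists x, peaks k x.
Proof.
move=> k1.
have /fin_all_exists [x xP] (b : 'I_n) := G_attains (norm_mul_root b k1).
exists x => b; have [x0 Px Gx] := xP b; split=> //.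
have zero (c : 'I_n) y : c != b -> P *m y = 0 -> dot y (G (k * w ^+ c) *m x b) = 0.
  move=> cb Py; apply: (@semidefinite_null _ _ _ (fun z => P *m z = 0) (x b)).
  - exact: dagG.
  - by move=> a; rewrite mulmxDr -scalemxAr Px Py scaler0 addr0.
  - by move=> z; apply: G_ge0; rewrite norm_mul_root.
  - by rewrite G_ge0 ?norm_mul_root.
  have := G_sum_dot k1 Px; rewrite (bigD1 b) //= Gx => /eqP.
  rewrite addrC -subr_eq0 addrK psumr_eq0 => [/allP/(_ c (mem_index_enum c))|d _].
    by rewrite cb => /eqP.
  by rewrite G_ge0 ?norm_mul_root.
move=> c y Py; have [->|cb] := eqVneq c b; last by rewrite (zero _ _ cb Py).
have : \sum_(d < n) dot y (G (k * w ^+ d) *m x b) = n%:R * dot y (x b).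
  by rewrite -dot_sumr -mulmx_suml G_sum // -scalemxAl dotZr defect_ker.
by rewrite (bigD1 b) //= big1 ?addr0 // => d db; apply: zero.
Qed.

(** Pairing [x c] with [G (k * w ^+ b) *m x b] gives [n] times the inner product; moving the
    Hermitian factor onto [x c] gives 0. *)
Lemma peaks_orthogonal k x : `|k| = 1 -> peaks k x ->
  forall b c : 'I_n, c != b -> dot (x c) (x b) = 0.
Proof.
move=> k1 xP b c cb; have [_ Pb Gb] := xP b; have [_ Pc Gc] := xP c.
have := Gb b (x c) Pc; rewrite eqxx => nxx.
have := Gc b (x b) Pb; rewrite eq_sym (negPf cb) => Gcb.
have : n%:R * dot (x c) (x b) == 0.
  by rewrite -nxx dot_dagr -dagG -dotC Gcb conjC0.
by rewrite mulf_eq0 pnatr_eq0 eqn0Ngt n_gt0 => /eqP.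
Qed.

Definition cols (x : 'I_n -> 'cV[C]_n) : 'M[C]_n := \matrix_(i, j) x j i 0.

Lemma mul_cols_col (A : 'M[C]_n) x b : A *m x b = col b (A *m cols x).
Proof.
rewrite !colE -mulmxA -colE; congr (_ *m _).
by apply/colP=> i; rewrite !mxE.
Qed.

Lemma eq_mul_cols (A B : 'M[C]_n) x : (forall b, A *m x b = B *m x b) -> A *m cols x = B *m cols x.
Proof.
move=> AB; apply/matrixP=> i b; have /colP/(_ i) := AB b.
by rewrite !mul_cols_col mxE [in RHS]mxE.
Qed.

Lemma peaks_unit k x : `|k| = 1 -> peaks k x -> cols x \in unitmx.
Proof.
move=> k1 xP.
pose D := diag_mx (\row_b (vnorm2 (x b))^-1).
have : (D *m dag (cols x)) *m cols x = 1%:M.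
  apply/matrixP=> c b; rewrite -mulmxA mul_diag_mx !mxE.
  rewrite (_ : \sum_j _ = dot (x c) (x b)); last first.
    by rewrite dotE; apply: eq_bigr => j _; rewrite dagE !mxE.
  have [->|cb] := eqVneq c b; last by rewrite (peaks_orthogonal k1 xP cb) mulr0.
  by have [x0 _ _] := xP b; rewrite -vnorm2E mulVf ?vnorm2_eq0.
by move=> /mulmx1_unit [].
Qed.

(** The [n] independent vectors [x b] lie in the kernel of [P], so [P = 0]. *)
Lemma phi1_isometry_root : dag X *m X = 1%:M.
Proof.
have [x xP] := peaks_exist (normr1 C).
have xU := peaks_unit (normr1 C) xP.
suff : P = 0 by move=> /subr0_eq.
rewrite -[P](mulmxK xU) (@eq_mul_cols P 0) ?mul0mx // => b.
by have [_ -> _] := xP b; rewrite mul0mx.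
Qed.

(** With [P = 0] the test vectors in [peaks] range over the whole space, so its weak identities
    become vector equations. *)
Lemma peaks_eigen k x (b c : 'I_n) : peaks k x ->
  G (k * w ^+ c) *m x b = if c == b then n%:R *: x b else 0.
Proof.
move=> xP; have [_ _ Gx] := xP b; apply/subr0_eq/dotr_inj => y.
rewrite dotDr dotNr Gx; last by rewrite /P phi1_isometry_root subrr mul0mx.
by case: eqP; rewrite ?dotZr ?dot0r subrr.
Qed.

Lemma Y_peaks k x r b : `|k| = 1 -> peaks k x -> (r <= n)%N ->
  (Y r + k ^+ n *: dag (Y (n - r))) *m x b = (k * w ^+ b) ^+ r *: x b.
Proof.
move=> k1 xP; have k0 : k != 0 by rewrite -normr_eq0 k1 oner_eq0.
rewrite leq_eqVlt => /predU1P [->|rn].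
  (* The case [r = n], outside the range of [G_fourier], follows from [Y n = 0], [Y 0 = 1] and
     [w ^+ n = 1]. *)
  rewrite Yn subnn dagY0 /Y expr0 phi1_isometry_root add0r -scalemxAl mul1mx exprMn.
  by rewrite exprAC (prim_expr_order w_prim) expr1n mulr1.
have n0 : (n%:R : C) != 0 by rewrite pnatr_eq0 -lt0n.
apply: (scalerI (_ : n%:R * k^-1 ^+ r != 0)).
  by rewrite mulf_neq0 ?expf_neq0 ?invr_neq0.
rewrite scalemxAl -G_fourier // mulmx_suml (bigD1 b) //= big1 => [|c cb].
  rewrite -scalemxAl (peaks_eigen _ _ xP) eqxx addr0 !scalerA; congr (_ *: _).
  rewrite exprMn -[RHS]mulrA [k^-1 ^+ r * _]mulrA -exprMn mulVf // expr1n mul1r.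
  by rewrite mulrC exprAC.
by rewrite -scalemxAl (peaks_eigen _ _ xP) (negPf cb) scaler0.
Qed.

(** All three matrices are diagonal in the basis [x b], with eigenvalues the powers [r], 1 and
    [r + 1] of [k * w ^+ b]. *)
Lemma Y_mul_root k r : `|k| = 1 -> (r < n)%N ->
  (Y r + k ^+ n *: dag (Y (n - r))) *m (Y 1 + k ^+ n *: dag (Y (n - 1))) =
  Y r.+1 + k ^+ n *: dag (Y (n - r.+1)).
Proof.
move=> k1 rn; have [x xP] := peaks_exist k1; have xU := peaks_unit k1 xP.
set L := LHS; set R := RHS; rewrite -[L](mulmxK xU) -[R](mulmxK xU); congr (_ *m _).
apply: eq_mul_cols => b.
rewrite /L /R -mulmxA !Y_peaks // -scalemxAr Y_peaks // 1?ltnW //.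
by rewrite scalerA expr1 -exprS.
Qed.

End Roots.

(** * Algebraic relations between the matrices [Y r] *)

Lemma phi1_isometry : dag X *m X = 1%:M.
Proof.
by have [w w_prim] := prim_root_exists C n_gt0; exact: phi1_isometry_root w_prim.
Qed.

Lemma Y0 : Y 0 = 1%:M.
Proof. by rewrite /Y expr0 phi1_isometry. Qed.

Lemma Y_mul z r : `|z| = 1 -> (r < n)%N ->
  (Y r + z *: dag (Y (n - r))) *m (Y 1 + z *: dag (Y (n - 1))) =
  Y r.+1 + z *: dag (Y (n - r.+1)).
Proof.
move=> z1 rn; have [w w_prim] := prim_root_exists C n_gt0.
have kn : n.-root z ^+ n = z by rewrite rootCK.
have k1 : `|n.-root z| = 1.
  have : `|n.-root z| ^+ n == 1 by rewrite -normrX kn z1.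
  by rewrite pexpr_eq1 // => /eqP.
by have := Y_mul_root w_prim k1 rn; rewrite kn.
Qed.

(** Three values suffice: [1] and [-1] isolate [A1], then adding the cases [1] and ['i] cancels
    [A2]. *)
Lemma quadratic_eq0 (A0 A1 A2 : 'M[C]_n) :
  (forall z, `|z| = 1 -> A0 + z *: A1 + (z * z) *: A2 = 0) -> A0 = 0 /\ A1 = 0.
Proof.
move=> Q; have Q1 := Q 1 (normr1 _); have QN := Q (-1) (normrN1 _).
have Qi := Q 'i (normCi _).
have two0 : (2 : C) != 0 by rewrite pnatr_eq0.
suff Aij i j : A0 i j = 0 /\ A1 i j = 0.
  by split; apply/matrixP=> i j; rewrite mxE; have [] := Aij i j.
have := congr1 (fun M : 'M_n => M i j) Qi; rewrite !mxE -expr2 sqrCi => Qi_ij.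
have := congr1 (fun M : 'M_n => M i j) QN; rewrite !mxE => QN_ij.
have := congr1 (fun M : 'M_n => M i j) Q1; rewrite !mxE => Q1_ij.
have A1ij : A1 i j = 0.
  apply: (mulfI two0); rewrite mulr0 -[RHS](subrr 0) -{1}Q1_ij -QN_ij; ring.
split=> //; apply: (mulfI two0); rewrite mulr0 -[RHS](addr0 0) -{1}Q1_ij -Qi_ij A1ij; ring.
Qed.

Lemma Y_relations r : (r < n)%N ->
  Y r *m Y 1 = Y r.+1 /\ Y r *m dag (Y (n - 1)) + dag (Y (n - r)) *m Y 1 = dag (Y (n - r.+1)).
Proof.
move=> rn.
have [|e0 e1] := @quadratic_eq0 (Y r *m Y 1 - Y r.+1)
  (Y r *m dag (Y (n - 1)) + dag (Y (n - r)) *m Y 1 - dag (Y (n - r.+1)))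
  (dag (Y (n - r)) *m dag (Y (n - 1))).
  move=> z z1; have /eqP := Y_mul z1 rn; rewrite -subr_eq0 => /eqP <-.
  rewrite mulmxDl !mulmxDr -!scalemxAl -!scalemxAr scalerA.
  set A := Y r *m _; set B := Y r *m _; set D := _ *m Y 1; set E := _ *m dag _.
  set F := dag (Y _); set H := Y r.+1.
  by move: A B D E F H => A B D E F H; apply/matrixP=> i j; rewrite !mxE; ring.
by split; apply: subr0_eq.
Qed.

Lemma phi_exp r : (r <= n)%N -> phi (S ^+ r) = X *m Y 1 ^+ r.
Proof.
move=> rn; rewrite (_ : Y 1 ^+ r = Y r).
  by rewrite /Y mulmxA (mulmx1C phi1_isometry) mul1mx.
elim: r rn => [|r IHr] rn; first by rewrite expr0 Y0.
by rewrite exprSr IHr ?(ltnW rn) // -mulmxE; have [-> _] := Y_relations rn.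
Qed.

Lemma shift_image : exists N : 'M[C]_n, [/\ N ^+ n = 0,
  dag N *m N + N ^+ n.-1 *m dag (N ^+ n.-1) = 1%:M &
  forall r, (r <= n)%N -> phi (S ^+ r) = X *m N ^+ r].
Proof.
have YE r : (r <= n)%N -> Y 1 ^+ r = Y r.
  by move=> rn; rewrite {2}/Y phi_exp // mulmxA phi1_isometry mul1mx.
exists (Y 1); split; [by rewrite YE // Yn| |exact: phi_exp].
(* At [r = n - 1] the right side of the second relation is [dag (Y 0) = 1]. *)
have lt_n : (n.-1 < n)%N by rewrite prednK.
have [_] := Y_relations lt_n.
have n_pred : (n - n.-1 = 1)%N by rewrite -subn1 subKn.
by rewrite n_pred prednK // subnn Y0 dag1 subn1 addrC YE ?leq_pred.
Qed.

End ToeplitzIsometry.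

(** * Partial isometries of maximal nilpotency index *)

Section Shift.
Variable C : numClosedFieldType.

(** [E] projects onto the kernel of [N], and [|x|^2 = |N x|^2 + |E x|^2] telescopes along the powers
    of [N]. A suitable unit vector then starts an orthonormal chain of length [n] under [N]. *)
Lemma nilpotent_shift n (N : 'M[C]_n) : (0 < n)%N -> N ^+ n = 0 ->
  dag N *m N + N ^+ n.-1 *m dag (N ^+ n.-1) = 1%:M ->
  exists W : 'M[C]_n, dag W *m W = 1%:M /\ N *m W = W *m jordanS C n.
Proof.
move=> n_gt0 Nn; set m := n.-1; set E := _ *m dag (N ^+ m) => NNE.
have ED : E = N ^+ m *m dag (N ^+ m) by [].
have mn : m.+1 = n by rewrite prednK.
have EE : E = dag E by rewrite /E dagM dagK.
have NE : N *m E = 0 by rewrite /E mulmxA mulmxE -exprS mn Nn mul0r.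
have Eid : E *m E = E.
  by rewrite -[RHS]mul1mx -NNE mulmxDl -[dag N *m N *m E]mulmxA NE mulmx0 add0r.
clearbody E; have dotN x y : dot x y = dot (N *m x) (N *m y) + dot (E *m x) (E *m y).
  rewrite [dot (N *m x) _]dot_dagl [dot (E *m x) _]dot_dagl -EE -dotDr !mulmxA Eid.
  by rewrite -mulmxDl NNE mul1mx.
have norm_sum x : vnorm2 x = \sum_(j < n) vnorm2 (E *m (N ^+ j *m x)).
  suff sum_k k : vnorm2 x = vnorm2 (N ^+ k *m x) + \sum_(j < k) vnorm2 (E *m (N ^+ j *m x)).
    by rewrite (sum_k n) Nn mul0mx vnorm20 add0r.
  elim: k => [|k ->]; first by rewrite big_ord0 addr0 expr0 mul1mx.
  rewrite big_ord_recr /= addrA addrAC; congr (_ + _).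
  by rewrite [LHS]vnorm2E dotN -!vnorm2E mulmxA mulmxE -exprS.
(* [E] is nonzero, since otherwise the telescoped norm of a basis vector would vanish. *)
have [g Eg g1] : exists2 g, E *m g = g & vnorm2 g = 1.
  pose o : 'cV[C]_n := \col_i (i == Ordinal n_gt0)%:R.
  have [j Ej] : exists j : 'I_n, E *m (N ^+ j *m o) != 0.
    have [/existsP //|] := boolP [exists j : 'I_n, E *m (N ^+ j *m o) != 0].
    rewrite negb_exists => /forallP E0.
    have /eqP := norm_sum o; rewrite big1 => [|j _]; last first.
      by have := E0 j; rewrite negbK => /eqP ->; rewrite vnorm20.
    rewrite vnorm2_eq0 => /eqP/colP/(_ (Ordinal n_gt0)) /eqP.
    by rewrite !mxE eqxx oner_eq0.
  set h := E *m _ in Ej.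
  exists ((sqrtC (vnorm2 h))^-1 *: h); first by rewrite -scalemxAr /h !mulmxA Eid.
  rewrite vnorm2Z normfV ger0_norm ?sqrtC_ge0 ?vnorm2_ge0 // exprVn sqrtCK.
  by rewrite mulVf ?vnorm2_eq0.
(* The chain is pulled back from its end: this start makes [h m = E *m g = g]. *)
pose h j := N ^+ j *m (dag (N ^+ m) *m g).
have hm : h m = g by rewrite /h mulmxA -ED.
have hn : h n = 0 by rewrite /h Nn mul0mx.
have hS j : N *m h j = h j.+1 by rewrite /h mulmxA mulmxE -exprS.
have h0 : vnorm2 (h 0) = 1.
  by rewrite /h expr0 mul1mx vnorm2E dot_dagl dagK mulmxA -ED Eg -vnorm2E.
(* The term [j = m] of the telescoped sum already exhausts the norm of [h 0]. *)
have Eh j : (j < m)%N -> E *m h j = 0.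
  have := norm_sum (h 0); rewrite h0 {1}/h expr0 mul1mx => /eqP.
  have lt_mn : (m < n)%N by rewrite mn.
  rewrite (bigD1 (Ordinal lt_mn)) //= -/(h m) hm Eg g1 eq_sym addrC -subr_eq0 addrK.
  rewrite psumr_eq0 => [/allP E0 jm|i _]; last exact: vnorm2_ge0.
  have jn := ltn_trans jm lt_mn.
  have := E0 (Ordinal jn) (mem_index_enum _).
  by rewrite -val_eqE /= (ltn_eqF jm) vnorm2_eq0 => /eqP.
clearbody h.
have dot_shift a b c :
    (a + c < n)%N -> dot (h a) (h b) = dot (h (a + c)%N) (h (b + c)%N).
  elim: c => [|c IHc] acn; first by rewrite !addn0.
  rewrite IHc; last by rewrite (leq_trans _ acn) // addnS.
  by rewrite dotN Eh ?dot0l ?addr0 ?hS ?addnS // -ltnS mn -addnS.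
have dot_lt a b : (a < b)%N -> (b < n)%N -> dot (h a) (h b) = 0.
  (* Shifting by [n - b] moves [h b] to [h n = 0], while the first index stays below [n]. *)
  move=> ab bn; rewrite (dot_shift _ _ (n - b)%N).
    by rewrite subnKC ?(ltnW bn) // hn dot0r.
  by rewrite addnC -ltn_subRL subKn // ltnW.
have hh a b : (a < n)%N -> (b < n)%N -> dot (h a) (h b) = (a == b)%:R.
  move=> an bn; have [ab|ba|->] := ltngtP a b; first exact: dot_lt.
    by rewrite -dotC dot_lt // conjC0.
  by have := dot_shift 0%N 0%N b bn; rewrite !add0n -vnorm2E h0 => <-.
have mj (j : 'I_n) : (m - j < n)%N by rewrite -[ltnRHS]mn ltnS leq_subr.
have jm (j : 'I_n) : (j <= m)%N by rewrite -ltnS [ltnRHS]mn.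
(* The order is reversed because [N] raises the index of [h] while [jordanS] lowers that of a basis
   vector. *)
exists (\matrix_(i, j) h (m - j)%N i 0); split; apply/matrixP=> i j.
  rewrite !mxE (_ : \sum_k _ = dot (h (m - i)%N) (h (m - j)%N)).
    rewrite hh // -val_eqE /=; congr (_%:R); congr (nat_of_bool _).
    by apply/eqP/eqP=> [/(congr1 (subn m))|->] //; rewrite !subKn.
  by rewrite dotE; apply: eq_bigr => k _; rewrite dagE !mxE.
rewrite [RHS]mxE; transitivity ((N *m h (m - j)%N) i 0).
  by rewrite !mxE; apply: eq_bigr => k _; rewrite mxE.
rewrite hS; have [j0|j_gt0] := posnP j.
  rewrite j0 subn0 mn hn mxE big1 // => k _.
  by rewrite !mxE j0 mulr0.
have lt_j : (j.-1 < n)%N by rewrite (leq_ltn_trans (leq_pred _)).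
rewrite (bigD1 (Ordinal lt_j)) //= big1 ?addr0 => [|k kj].
  rewrite !mxE /= prednK // eqxx mulr1 -subSn //; congr (h _ i 0).
  by rewrite -[in RHS]subSS prednK.
rewrite !mxE (_ : (_ == k.+1 :> nat) = false) ?mulr0 //.
by apply: contraNF kj => /eqP jk; rewrite -val_eqE /= jk.
Qed.

End Shift.

Theorem theorem5p1 (C : numClosedFieldType) (n : nat)
    (phi : 'M[C]_n -> 'M[C]_n)
    (phi_lin : forall (a : C) (A B : 'M[C]_n), in_toeplitz A -> in_toeplitz B ->
                 phi (a *: A + B) = a *: phi A + phi B)
    (phi_iso : forall (A : 'M[C]_n) (r : C), in_toeplitz A ->
                 (is_opnorm (phi A) r <-> is_opnorm A r)) :
  exists U V : 'M[C]_n, [/\ unitary U, unitary V &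
    forall A : 'M[C]_n, in_toeplitz A -> phi A = U *m A *m V].
Proof.
have [n0|n_gt0] := posnP n.
  have eq0 (A B : 'M[C]_n) : A = B by apply/matrixP=> i; have := ltn_ord i; rewrite [ltnRHS]n0.
  by exists 1%:M, 1%:M; split=> [||A _]; exact: eq0.
have phi_sqbounded (A : 'M[C]_n) a : in_toeplitz A -> 0 <= a ->
    (sqbounded (phi A) a <-> sqbounded A a).
  by move=> tA; apply: sqbounded_iff => r; exact: phi_iso.
have XX := phi1_isometry n_gt0 phi_lin phi_sqbounded.
have [N [Nn NNE phiN]] := shift_image n_gt0 phi_lin phi_sqbounded.
have [W [WW NW]] := nilpotent_shift n_gt0 Nn NNE.
have WV := mulmx1C WW.
exists (phi 1%:M *m W), (dag W); split.
- by rewrite /unitary /adjmx -!/(dag _) dagM mulmxA -[_ *m _ *m phi _]mulmxA XX mulmx1.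
- by rewrite /unitary /adjmx -!/(dag _) dagK.
have N_exp r : N ^+ r = W *m jordanS C n ^+ r *m dag W.
  elim: r => [|r IHr]; first by rewrite !expr0 mulmx1.
  by rewrite !exprS -!mulmxE IHr !mulmxA NW.
(* The degree of [p] may exceed [n], where [phiN] does not apply but both sides vanish. *)
have S_ge r : (n < r)%N -> jordanS C n ^+ r = 0.
  by move=> /ltnW/subnK <-; rewrite exprD jordanS_nilpotent mulr0.
move=> A [p ->]; rewrite /poly_at_mx (phi_sum phi_lin) mulmx_sumr mulmx_suml.
apply: eq_bigr => r _; rewrite -!scalemxAr -scalemxAl; congr (_ *: _).
have [rn|nr] := leqP r n; first by rewrite phiN // N_exp !mulmxA.
by rewrite S_ge // (phi0 phi_lin) mulmx0 mul0mx.
Qed.
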